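(* Let $f\in\mathbb{Q}^2$ and $R=\{r^1,\dots,r^k\}\subset\mathbb{Q}^2$. There exists a finite subset $\Xi_3\subseteq\Delta_3$ such that for every $\gamma\in\Delta_3\setminus\Xi_3$ there exist $\gamma^1,\gamma^2\in\Delta$ such that $\gamma$ is a strict convex combination of $\gamma^1$ and $\gamma^2$. Moreover, the cardinality of $\Xi_3$ is bounded polynomially in the binary encoding sizes of $f,r^1,\dots,r^k$. Specifically, $\Xi_3$ can be chosen as the set of all $\gamma(B)$ such that $B\in\mathbb{R}^{3\times2}$, $M(B)$ is a Type 3 triangle, and one of the following holds: Case a. $P(B,R)\subset\mathbb{Z}^2$. Case b. $M(B)$ has three corner rays, that is, $\operatorname{vert}(B)\subseteq P(B,R)$.
   Context: For $B\in\mathbb{R}^{n\times 2}$ with rows $b^1,\dots,b^n$: $M(B)=\{x\in\mathbb{R}^2 : b^i\cdot(x-f)\le 1,\ i=1,\dots,n\}$ (so $f\in\operatorname{int}M(B)$), $\operatorname{vert}(B)$ is the set of vertices of $M(B)$, $\psi_B(r)=\max_i b^i\cdot r$, $\gamma(B)=(\psi_B(r^j))_{j=1}^k$. The set of ray intersections is $P(B,R)=\{f+\tfrac{1}{\psi_B(r)}r : r\in R,\ \psi_B(r)>0\}$; these are points on the boundary of $M(B)$. A convex set in $\mathbb{R}^2$ is lattice-free if its interior contains no point of $\mathbb{Z}^2$; it is maximal lattice-free if it is inclusion-maximal among lattice-free convex sets. A Type 3 triangle is a maximal lattice-free triangle with exactly three integral points on its boundary, one in the relative interior of each edge. $\Delta=\{\gamma(B):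 B\in\mathbb{R}^{3\times 2},\ M(B)\text{ lattice-free (not necessarily maximal)}\}$ and $\Delta_3=\{\gamma(B): B\in\mathbb{R}^{3\times2},\ M(B)\text{ is a Type 3 triangle}\}$. A point $x$ is a strict convex combination of $y^1$ and $y^2$ if $y^1\ne y^2$ and $x=\tfrac12(y^1+y^2)$. ''Bounded polynomially'' means bounded by a fixed polynomial, independent of the data, in the total encoding size. *)

(* Defs.v *)
From HB Require Import structures.
From mathcomp Require Import all_boot all_order all_algebra.
From mathcomp Require Import all_classical all_reals all_analysis.

Set Implicit Arguments.
Unset Strict Implicit.
Unset Printing Implicit Defensive.

Import Order.TTheory GRing.Theory Num.Theory.
Import numFieldNormedType.Exports.

Local Open Scope classical_set_scope.
Local Open Scope ring_scope.

Definition dot {R : realType} (u v : 'rV[R]_2) : R := (u *m v^T) 0 0.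

Definition Z2 {R : realType} : set 'rV[R]_2 :=
  [set x | forall j, x 0 j \is a Num.int].

Definition boundary {R : realType} (A : set 'rV[R]_2) : set 'rV[R]_2 :=
  closure A `\` interior A.

Definition lattice_free {R : realType} (A : set 'rV[R]_2) : Prop :=
  convex_set A /\ interior A `&` Z2 = set0.

Definition maximal_lattice_free {R : realType} (A : set 'rV[R]_2) : Prop :=
  lattice_free A /\
  forall C : set 'rV[R]_2, lattice_free C -> A `<=` C -> C = A.

Definition affinely_independent {R : realType} (v : 'I_3 -> 'rV[R]_2) : Prop :=
  forall c : 'I_3 -> R,
    \sum_i c i = 0 -> \sum_i c i *: v i = 0 -> forall i, c i = 0.

Definition conv_hull {R : realType} (v : 'I_3 -> 'rV[R]_2) : set 'rV[R]_2 :=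
  [set x | exists c : 'I_3 -> R,
     [/\ forall i, 0 <= c i, \sum_i c i = 1 & x = \sum_i c i *: v i]].

(* Relative interior of the edge opposite to the vertex v i. *)
Definition edge_relint {R : realType} (v : 'I_3 -> 'rV[R]_2) (i : 'I_3) :
    set 'rV[R]_2 :=
  [set x | exists c : 'I_3 -> R,
     [/\ c i = 0, forall j, j != i -> 0 < c j, \sum_j c j = 1
       & x = \sum_j c j *: v j]].

Definition type3_triangle {R : realType} (A : set 'rV[R]_2) : Prop :=
  exists v : 'I_3 -> 'rV[R]_2,
    [/\ affinely_independent v, A = conv_hull v, maximal_lattice_free A,
        (boundary A `&` Z2 #= `I_3)%card
      & forall i, exists! z, (edge_relint v i `&` Z2) z].

Definition M {R : realType} (f : 'rV[R]_2) (n : nat) (B : 'M[R]_(n, 2)) :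
    set 'rV[R]_2 :=
  [set x | forall i, dot (row i B) (x - f) <= 1].

Definition vert {R : realType} (f : 'rV[R]_2) (n : nat) (B : 'M[R]_(n, 2)) :
    set 'rV[R]_2 :=
  [set x | M f B x /\
     forall (y z : 'rV[R]_2) (t : R), M f B y -> M f B z -> 0 < t < 1 ->
       x = t *: y + (1 - t) *: z -> y = z].

(* At least one row is required for the maximum to make sense. Its default
   value is the first term, so it does not change the maximum. *)
Definition psi {R : realType} (n : nat) (B : 'M[R]_(n.+1, 2)) (r : 'rV[R]_2) :
    R :=
  \big[Num.max/dot (row ord0 B) r]_i dot (row i B) r.

Definition gamma {R : realType} (k : nat) (r : 'I_k -> 'rV[R]_2) (n : nat)
    (B : 'M[R]_(n.+1, 2)) : 'rV[R]_k :=
  \row_j psi B (r j).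

Definition ray_intersections {R : realType} (f : 'rV[R]_2) (k : nat)
    (r : 'I_k -> 'rV[R]_2) (n : nat) (B : 'M[R]_(n.+1, 2)) : set 'rV[R]_2 :=
  [set f + (psi B (r j))^-1 *: r j | j in [set j | 0 < psi B (r j)]].

Definition Delta {R : realType} (f : 'rV[R]_2) (k : nat)
    (r : 'I_k -> 'rV[R]_2) : set 'rV[R]_k :=
  [set gamma r B | B in [set B : 'M[R]_(3, 2) | lattice_free (M f B)]].

Definition Delta3 {R : realType} (f : 'rV[R]_2) (k : nat)
    (r : 'I_k -> 'rV[R]_2) : set 'rV[R]_k :=
  [set gamma r B | B in [set B : 'M[R]_(3, 2) | type3_triangle (M f B)]].

Definition strict_convex_combination {R : realType} (k : nat)
    (x y1 y2 : 'rV[R]_k) : Prop :=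
  y1 <> y2 /\ x = 2^-1 *: (y1 + y2).

(* Binary encoding sizes as in Schrijver, Theory of Linear and Integer
   Programming, Section 3.2: up_log 2 (m + 1) is the ceiling of
   log_2 (m + 1). *)
Definition rat_size (x : rat) : nat :=
  (1 + up_log 2 (absz (numq x) + 1) + up_log 2 (absz (denq x) + 1))%N.

Definition vec_size (n : nat) (u : 'rV[rat]_n) : nat :=
  (n + \sum_j rat_size (u ord0 j))%N.

Definition input_size (k : nat) (f : 'rV[rat]_2) (r : 'I_k -> 'rV[rat]_2) :
    nat :=
  (vec_size f + \sum_j vec_size (r j))%N.

Definition rat_vec (R : realType) (n : nat) (u : 'rV[rat]_n) : 'rV[R]_n :=
  map_mx ratr u.

(* Main.v *)
Require Import Defs.
From mathcomp Require Import all_boot all_order all_algebra.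
From mathcomp Require Import all_classical all_reals all_analysis.
From mathcomp Require Import ring lra zify.

(* Let [b_i] be the rows of [B], [y_i] the lattice point of edge [i] and [w_l]
   the vertices seen from [f].

   If some vertex lies on no ray, tilt each edge about its lattice point: take
   directions [d_i] orthogonal to [y_i - f] and, at each of the at most two
   vertices lying on a ray, require that the two edges stay concurrent with the
   ray.  This system has a solution with all [d_i <> 0].  For small [e] the sets
   [M (B +- e D)] are still lattice-free and [gamma] is affine in [e]; it is not
   constant as soon as some ray intersection is not one of the [y_i].

   In case a, [gamma] is unique, since each ray meets the boundary at its first
   lattice point.  In case b, the values [s_l] of [psi B] on the corner rays
   satisfy [a_i s_(i+1) + b_i s_(i+2) = 1], where [a_i, b_i > 0] are the
   coordinates of [y_i - f] in the two corner rays of edge [i]; this system is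
   nonsingular, so the corner rays and the [y_i] determine [gamma].  For fixed
   corner rays, scale [a_i] and [b_i] to integers: if two candidates [y], [y']
   have scaled coordinates in the same dyadic intervals, then [y'] and [2 y - y'] lie
   in the open corner cone, hence on the supporting line at [y], and [y = y'].
   Similarly [a_i] is at most the denominator of its ray, for otherwise [y_i]
   could be shifted both ways along an integral multiple of the ray.  So there
   are polynomially many pairs of dyadic intervals. *)

Set Implicit Arguments.
Unset Strict Implicit.
Unset Printing Implicit Defensive.

Import Order.TTheory GRing.Theory Num.Theory.
Import numFieldNormedType.Exports.

Local Open Scope classical_set_scope.
Local Open Scope ring_scope.

(** * Inner products and determinants in the plane *)

Section Dot.
Variable R : realType.
Implicit Types (u v w : 'rV[R]_2) (a : R).

Lemma dotE u v : dot u v = u 0 0 * v 0 0 + u 0 1 * v 0 1.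
Proof.
rewrite /dot mxE big_ord_recl big_ord1 !mxE.
by congr (_ + u 0 _ * v 0 _); apply/val_inj.
Qed.

Lemma row2P u v : u 0 0 = v 0 0 -> u 0 1 = v 0 1 -> u = v.
Proof.
move=> e0 e1; apply/rowP => -[[|[|//]] h].
  by rewrite (_ : Ordinal h = 0) //; apply/val_inj.
by rewrite (_ : Ordinal h = 1) //; apply/val_inj.
Qed.

Lemma dotDr u v w : dot u (v + w) = dot u v + dot u w.
Proof. by rewrite !dotE !mxE; ring. Qed.

Lemma dotDl u v w : dot (u + v) w = dot u w + dot v w.
Proof. by rewrite !dotE !mxE; ring. Qed.

Lemma dotZr a u v : dot u (a *: v) = a * dot u v.
Proof. by rewrite !dotE !mxE; ring. Qed.

Lemma dotZl a u v : dot (a *: u) v = a * dot u v.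
Proof. by rewrite !dotE !mxE; ring. Qed.

Lemma dotNr u v : dot u (- v) = - dot u v.
Proof. by rewrite !dotE !mxE; ring. Qed.

Lemma dotBr u v w : dot u (v - w) = dot u v - dot u w.
Proof. by rewrite dotDr dotNr. Qed.

Lemma dot0r u : dot u 0 = 0.
Proof. by rewrite dotE !mxE; ring. Qed.

Lemma dot0l u : dot 0 u = 0.
Proof. by rewrite dotE !mxE; ring. Qed.

Lemma dot_sumr u (I : finType) (F : I -> 'rV[R]_2) :
  dot u (\sum_i F i) = \sum_i dot u (F i).
Proof. exact: (big_morph (dot u) (dotDr u) (dot0r u)). Qed.

Lemma dot_suml u (I : finType) (F : I -> 'rV[R]_2) :
  dot (\sum_i F i) u = \sum_i dot (F i) u.
Proof.
exact: (big_morph (dot^~ u) (fun v w => dotDl v w u) (dot0l u)).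
Qed.

Definition det2 u v := u 0 0 * v 0 1 - u 0 1 * v 0 0.

Lemma det2_eq0 u v w : det2 u v != 0 -> dot w u = 0 -> dot w v = 0 -> w = 0.
Proof.
rewrite /det2 !dotE => /eqP d e1 e2.
have h : forall z, z * (u 0 0 * v 0 1 - u 0 1 * v 0 0) = 0 -> z = 0.
  by move=> z /eqP; rewrite mulf_eq0 => /orP[/eqP//|/eqP].
apply: row2P; rewrite mxE; apply: h.
  transitivity (v 0 1 * (w 0 0 * u 0 0 + w 0 1 * u 0 1) -
    u 0 1 * (w 0 0 * v 0 0 + w 0 1 * v 0 1)); first by ring.
  by rewrite e1 e2; ring.
transitivity (u 0 0 * (w 0 0 * v 0 0 + w 0 1 * v 0 1) -
  v 0 0 * (w 0 0 * u 0 0 + w 0 1 * u 0 1)); first by ring.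
by rewrite e1 e2; ring.
Qed.

(** Multiplicativity of the determinant, for the product of the matrix with rows [u], [v] and the
    matrix with columns [w], [z]. *)
Lemma det2_dot u v w z :
  dot u w * dot v z - dot u z * dot v w = det2 u v * det2 w z.
Proof. by rewrite /det2 !dotE; ring. Qed.

End Dot.

(** * The gauge [psi], the interior of [M] and lattice-freeness *)

Section Psi.
Variables (R : realType) (n : nat).
Implicit Types (f x r : 'rV[R]_2) (B : 'M[R]_(n.+1, 2)).

Lemma psi_ge B r i : dot (row i B) r <= psi B r.
Proof. by rewrite /psi; exact: (le_bigmax _ (fun i => dot (row i B) r)). Qed.

Lemma psi_ex B r : exists i, psi B r = dot (row i B) r.
Proof.
rewrite /psi; elim/big_ind : _ => [|x y [i xi] [j yj]|i _]; first by exists ord0.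
  by case: (leP x y) => _; [exists j | exists i].
by exists i.
Qed.

Lemma psi_eq B r i :
  (forall j, dot (row j B) r <= dot (row i B) r) -> psi B r = dot (row i B) r.
Proof.
move=> h; apply/eqP; rewrite eq_le psi_ge andbT.
by have [j ->] := psi_ex B r.
Qed.

Lemma interior_segment (A : set 'rV[R]_2) x u :
  interior A x -> exists2 t, 0 < t & A (x + t *: u).
Proof.
move=> Ax.
have : (fun t : R => x + t *: u) @ (0 : R) --> (x + 0 *: u).
  by apply: cvgD; [exact: cvg_cst | apply: cvgZr_tmp; exact: cvg_id].
rewrite scale0r addr0 => /(_ _ Ax) /nbhs_ballP[e /= e0 h].
exists (e / 2); first by rewrite divr_gt0.
apply: h; rewrite /ball/= sub0r normrN gtr0_norm ?divr_gt0//.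
by rewrite ltr_pdivrMr// mulr_natr mulr2n ltrDl.
Qed.

Lemma strict_interior f B x :
  (forall i, dot (row i B) (x - f) < 1) -> interior (M f B) x.
Proof.
move=> h; rewrite /interior.
have : \forall z \near (x : 'rV[R]_2), forall i, dot (row i B) (z - f) < 1.
  apply: (@filter_forall _ _ (fun i (z : 'rV[R]_2) =>
    dot (row i B) (z - f) < 1) (nbhs x) (nbhs_filter x)) => i.
  have c : continuous (fun z : 'rV[R]_2 => dot (row i B) (z - f)).
    move=> z.
    rewrite (_ : (fun z => _) = fun z : 'rV[R]_2 =>
      row i B 0 0 * (z 0 0 - f 0 0) + row i B 0 1 * (z 0 1 - f 0 1)).
      have cc k (a b : R) : {for z, continuous
          (fun z : 'rV[R]_2 => a * (z 0 k - b))}.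
        apply: continuousM; first exact: cst_continuous.
        apply: continuousB; [exact: coord_continuous | exact: cst_continuous].
      exact: continuousD (cc _ _ _) (cc _ _ _).
    by apply/funext => z'; rewrite dotE [(z' - f) 0 0]mxE [(z' - f) 0 1]mxE !mxE.
  exact: (cvgr_lt _ (c x) 1 (h i)).
by apply: filterS => z hz i; apply/ltW.
Qed.

Lemma interior_strict f B x :
  interior (M f B) x -> forall i, dot (row i B) (x - f) < 1.
Proof.
move=> /(interior_segment (x - f))[t t0 /= h] i.
(* A value of at least 1 at [x] would grow by the factor [1 + t] at a point of [M f B]. *)
have := h i; rewrite addrAC (dotDr _ (x - f)) dotZr.
case: (ltP (dot (row i B) (x - f)) 1) => // h1; nra.
Qed.

Lemma convex_M f B : convex_set (M f B).
Proof.
move=> x y l /set_mem /= Mx /set_mem /= My; apply/mem_set => i /=.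
have -> : conv l x y - f = l%:num *: (x - f) + (1 - l%:num) *: (y - f).
  rewrite /conv /=; apply/rowP => j; rewrite !mxE /unstable.onem; ring.
rewrite (dotDr _ (_ *: _)) !dotZr.
have l0 : 0 <= l%:num by [].
have l1 : l%:num <= 1 by [].
have := Mx i; have := My i; nra.
Qed.

Lemma lattice_freeP f B :
  lattice_free (M f B) <->
  forall x, Z2 x -> exists i, 1 <= dot (row i B) (x - f).
Proof.
split=> [[_ h] x Zx|h].
  apply: contrapT => /forallNP N.
  suff : (interior (M f B) `&` Z2) x by rewrite h.
  split=> //; apply: strict_interior => i.
  by rewrite ltNge; apply/negP/N.
split; first exact: convex_M.
rewrite -subset0 => x [/interior_strict s /h[i]].
by rewrite leNgt s.
Qed.

End Psi.

(** * Barycentric calculus in a triangle around [f] *)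

Section Triangle.
Variable R : realType.
Implicit Types (f x r : 'rV[R]_2) (B : 'M[R]_(3, 2)).

(* [w i] is the vertex opposite to edge [i], seen from [f]; [c] are the
   barycentric coordinates of [f]. *)
Record triangle B (w : 'I_3 -> 'rV[R]_2) (c : 'I_3 -> R) : Prop := Triangle {
  tri_gt0 : forall i, 0 < c i;
  tri_sum : \sum_i c i = 1;
  tri_bary : \sum_i c i *: w i = 0;
  tri_dot : forall i j, dot (row i B) (w j) = 1 - (i == j)%:R / c i }.

Lemma sum_delta (I : finType) (a : I -> R) i : \sum_j a j * (i == j)%:R = a i.
Proof.
rewrite (bigD1 i) //= eqxx mulr1 big1 ?addr0 // => j /negPf.
by rewrite eq_sym => ->; rewrite mulr0.
Qed.

Lemma tri_neq0 B w c i : triangle B w c -> c i != 0.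
Proof. by move=> T; rewrite gt_eqF // (tri_gt0 T). Qed.

Lemma tri_dot_comb B w c (a : 'I_3 -> R) i : triangle B w c ->
  dot (row i B) (\sum_j a j *: w j) = \sum_j a j - a i / c i.
Proof.
move=> T; rewrite dot_sumr.
under eq_bigr do rewrite dotZr (tri_dot T) mulrBr mulr1 mulrA.
by rewrite sumrB -mulr_suml sum_delta.
Qed.

Lemma tri_dot_diag B w c i : triangle B w c ->
  dot (row i B) (w i) = 1 - (c i)^-1.
Proof. by move=> T; rewrite (tri_dot T) eqxx div1r. Qed.

Lemma tri_dot_off B w c i j : triangle B w c -> i != j ->
  dot (row i B) (w j) = 1.
Proof. by move=> T /negPf ij; rewrite (tri_dot T) ij mul0r subr0. Qed.

(** Addition in ['I_3] is modulo 3, so [i + 1] and [i + 2] are the other two indices. *)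
Lemma sum3 (V : nmodType) (F : 'I_3 -> V) i :
  \sum_j F j = F i + (F (i + 1) + F (i + 2)).
Proof.
rewrite (bigD1 i) //= (bigD1 (i + 1)) /=; last first.
  by case: i => [[|[|[|]]]].
rewrite (bigD1 (i + 2)) /=; last by case: i => [[|[|[|]]]].
rewrite big1 ?addr0 // => j.
by case: i => [[|[|[|]]]] // ?; case: j => [[|[|[|]]]].
Qed.

(** By [det2_dot] the product is [c i / (c (i + 1) * c (i + 2))]. Hence any two rows, and any two
    vertices, are linearly independent. *)
Lemma tri_det B w c i : triangle B w c ->
  det2 (row (i + 1) B) (row (i + 2) B) * det2 (w (i + 1)) (w (i + 2)) != 0.
Proof.
have [n12 n21] : i + 1 != i + 2 /\ i + 2 != i + 1.
  by case: i => [[|[|[|]]]].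
move=> T; rewrite -det2_dot !(tri_dot_diag _ T) !(tri_dot_off T) //.
have := tri_gt0 T i; have := tri_gt0 T (i + 1); have := tri_gt0 T (i + 2).
have := tri_sum T; rewrite (sum3 _ i) => s c2 c1 c0.
rewrite (_ : _ - _ = c i / (c (i + 1) * c (i + 2))); last first.
  rewrite (_ : c i = 1 - c (i + 1) - c (i + 2)); last by rewrite -s; ring.
  by field; rewrite !gt_eqF.
by rewrite mulf_eq0 invr_eq0 mulf_eq0 !gt_eqF.
Qed.

(** The rows weighted by [c] sum to a vector orthogonal to two independent vertices. *)
Lemma tri_rows B w c r : triangle B w c -> \sum_i c i * dot (row i B) r = 0.
Proof.
move=> T.
under eq_bigr do rewrite -dotZl.
rewrite -dot_suml; suff -> : \sum_i c i *: row i B = 0 by rewrite dot0l.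
have := tri_det 0 T; rewrite mulf_eq0 negb_or => /andP[_ /det2_eq0]; apply;
  rewrite dot_suml; under eq_bigr do rewrite dotZl (tri_dot T) mulrBr mulr1;
  rewrite sumrB (tri_sum T); apply/eqP; rewrite subr_eq0; apply/eqP.
  rewrite -[LHS](sum_delta (fun=> 1) (0 + 1 : 'I_3)); apply: eq_bigr => i _.
  by rewrite mul1r eq_sym mulrCA mulfV ?mulr1 // (tri_neq0 _ T).
rewrite -[LHS](sum_delta (fun=> 1) (0 + 2 : 'I_3)); apply: eq_bigr => i _.
by rewrite mul1r eq_sym mulrCA mulfV ?mulr1 // (tri_neq0 _ T).
Qed.

(** Both sides have the same product with every row, and two rows are already independent. *)
Lemma tri_decomp B w c r : triangle B w c ->
  r = - \sum_i (c i * dot (row i B) r) *: w i.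
Proof.
move=> T; apply/eqP; rewrite -subr_eq0 opprK; apply/eqP.
have z i : dot (row i B) (r + \sum_j (c j * dot (row j B) r) *: w j) = 0.
  rewrite dotDr (tri_dot_comb _ _ T) (tri_rows _ T) mulrAC mulfV ?mul1r ?sub0r.
    by rewrite subrr.
  exact: tri_neq0 T.
have := tri_det 0 T; rewrite mulf_eq0 negb_or => /andP[d _].
set g := r + _ in z *.
have dotC u v : dot u v = dot v u :> R by rewrite !dotE; ring.
by apply: (det2_eq0 d); rewrite dotC z.
Qed.

(** If no row is positive on [r], then by [tri_rows] all rows vanish on it, and [tri_decomp] gives
    [r = 0]. *)
Lemma tri_psi_gt0 B w c r : triangle B w c -> r != 0 -> 0 < psi B r.
Proof.
move=> T r0; rewrite ltNge; apply: contra r0 => p0.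
have le0 i : c i * dot (row i B) r <= 0.
  by rewrite pmulr_rle0 ?(tri_gt0 T) //; apply: le_trans p0; exact: psi_ge.
have := tri_rows r T; move/eqP; rewrite -oppr_eq0 -sumrN psumr_eq0; last first.
  by move=> i _; rewrite oppr_ge0.
move=> /allP z; rewrite [r](tri_decomp _ T) oppr_eq0 big1 // => i _.
have := z i (mem_index_enum i); rewrite /= oppr_eq0 => /eqP ->.
by rewrite scale0r.
Qed.

(** The data of a Type 3 triangle, with edges numbered by the rows of [B] instead of the vertices of
    a hull. *)
Record type3 f B w c (y : 'I_3 -> 'rV[R]_2) : Prop := Type3 {
  t3_tri : triangle B w c;
  t3_free : forall x, Z2 x -> exists i, 1 <= dot (row i B) (x - f);
  t3_int : forall i, Z2 (y i);
  t3_on : forall i, dot (row i B) (y i - f) = 1;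
  t3_lt : forall i j, i != j -> dot (row j B) (y i - f) < 1;
  t3_uniq : forall x, Z2 x -> M f B x -> exists i, x = y i }.

End Triangle.

(** * From the geometric definition of a Type 3 triangle to [type3] *)

Section Alignment.
Variable R : realType.
Implicit Types (f x r : 'rV[R]_2) (B : 'M[R]_(3, 2)).

(** If no row is tight at both ends of the edge, its midpoint [m] is interior to [M f B]. Then [m]
    can be pushed away from [v i] inside the hull, although this makes the coordinate at [v i]
    negative. *)
Lemma facet_of_edge f B v i :
  affinely_independent v -> M f B = conv_hull v ->
  exists l, forall j, j != i -> dot (row l B) (v j - f) = 1.
Proof.
move=> aff MB; apply: contrapT => /forallNP N.
have vM j : M f B (v j).
  rewrite MB; exists (fun k => (j == k)%:R); split => //.
    have := sum_delta (fun=> 1 : R) j; under eq_bigr do rewrite mul1r; exact.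
  rewrite (bigD1 j) //= eqxx scale1r big1 ?addr0 // => k /negPf.
  by rewrite eq_sym => ->; rewrite scale0r.
pose m := 2^-1 *: (v (i + 1) + v (i + 2)).
have : interior (M f B) m.
  apply: strict_interior => l.
  have -> : m - f = 2^-1 *: ((v (i + 1) - f) + (v (i + 2) - f)).
    by apply/rowP => k; rewrite !mxE; field.
  rewrite dotZr dotDr.
  have h1 := vM (i + 1) l; have h2 := vM (i + 2) l.
  rewrite mulrC ltr_pdivrMr // mul1r lt_neqAle; apply/andP; split; last by lra.
  apply/eqP => e; apply: (N l) => j ji.
  have [->|j1] := eqVneq j (i + 1); first by lra.
  suff -> : j = i + 2 by lra.
  by move: ji j1; case: i j {m N h1 h2 e} => [[|[|[|]]]] // ? [[|[|[|]]]] // ? _ _;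
    apply/val_inj.
move=> /(interior_segment (m - v i))[t t0]; rewrite MB => -[a [a0 a1 ma]].
(* The difference of two barycentric representations of [m + t *: (m - v i)]. *)
pose d k := if k == i then a k + t else a k - (1 + t) / 2.
have h : (i + 1 == i = false) * (i + 2 == i = false).
  by split; case: i {m ma d N} => [[|[|[|]]]].
have : d i = 0.
  apply: aff.
    rewrite (sum3 _ i) /d eqxx !h.
    by move: a1; rewrite (sum3 _ i); lra.
  rewrite (sum3 _ i) /d eqxx !h.
  move: ma; rewrite (sum3 _ i) => /(congr1 (fun z => z - (m + t *: (m - v i)))).
  by rewrite subrr => ->; apply/rowP => k; rewrite !mxE; field.
by rewrite /d eqxx; have := a0 i; lra.
Qed.

Lemma type3_triangleP f B : type3_triangle (M f B) ->
  exists w c y, type3 f B w c y /\ M f B = conv_hull (fun i => f + w i).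
Proof.
move=> [v [aff MB [lf _] card3 edges]].
have /choice[s sP] : forall i, exists l, forall j, j != i ->
    dot (row l B) (v j - f) = 1.
  by move=> i; apply: facet_of_edge.
have [a [a0 a1 fa]] : conv_hull v f.
  by rewrite -MB => i; rewrite subrr dot0r ler01.
(* A row supporting two edges would be 1 at all three vertices, hence also at [f], where it is 0. So
   [s] is a permutation, and its inverse [t] renumbers the vertices by rows. *)
have sI : injective s.
  move=> i i' e; apply/eqP/negPn/negP => ii'.
  have all1 j : dot (row (s i) B) (v j - f) = 1.
    have [->|] := eqVneq j i; last exact: sP.
    by rewrite e sP.
  have : dot (row (s i) B) (\sum_j a j *: (v j - f)) = 1.
    rewrite dot_sumr; under eq_bigr do rewrite dotZr all1 mulr1.
    by [].
  have -> : \sum_j a j *: (v j - f) = 0.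
    under eq_bigr do rewrite scalerBr.
    by rewrite sumrB -fa -scaler_suml a1 scale1r subrr.
  by rewrite dot0r => /eqP; rewrite eq_sym oner_eq0.
have [t st ts] := injF_bij (sI : injective (s : 'I_3 -> 'I_3)).
have tI : injective t := can_inj ts.
pose w l := v (t l) - f; pose c l := a (t l).
have re (V : nmodType) (F : 'I_3 -> V) : \sum_i F (t i) = \sum_i F i.
  by rewrite [RHS](reindex t) //; apply/onW_bij; exists s.
have dw i j : i != j -> dot (row i B) (w j) = 1.
  by move=> ij; rewrite -[i]ts sP // (inj_eq tI) eq_sym.
have cs : \sum_i c i = 1 by rewrite -a1 -(re _ a).
have cw : \sum_i c i *: w i = 0.
  rewrite (re _ (fun i => a i *: (v i - f))).
  under eq_bigr do rewrite scalerBr.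
  by rewrite sumrB -fa -scaler_suml a1 scale1r subrr.
(* Pair the relation [cw] with row [i], which is 1 at the other two vertices. *)
have cd i : 1 = c i * (1 - dot (row i B) (w i)).
  have := congr1 (dot (row i B)) cw; rewrite dot0r dot_sumr (bigD1 i) //=.
  under eq_bigr => j ji do rewrite dotZr dw 1?eq_sym // mulr1.
  by move: cs; rewrite (bigD1 i) //= dotZr => h1 h2; lra.
have c0 i : 0 < c i.
  rewrite lt_neqAle a0 andbT eq_sym; apply/eqP => ci.
  by have := cd i; rewrite ci mul0r => /eqP; rewrite oner_eq0.
have T : triangle B w c.
  split=> // i j; have [<-|ij] := eqVneq i j; last by rewrite dw // mul0r subr0.
  have := cd i => h; rewrite div1r.
  apply: (mulfI (lt0r_neq0 (c0 i))); rewrite mulrBr mulfV ?lt0r_neq0 //.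
  by rewrite {2}h; ring.
have /choice[y yP] : forall i, exists z, edge_relint v (t i) z /\ Z2 z.
  by move=> i; have [z [[]]] := edges (t i); exists z.
have ye i : exists2 b : 'I_3 -> R, b i = 0 /\ (forall j, j != i -> 0 < b j) &
    forall l, dot (row l B) (y i - f) = 1 - b l / c l.
  have [[b [b0 bp b1 yb]] _] := yP i; exists (b \o t).
    by split=> // j ji /=; apply: bp; rewrite (inj_eq tI).
  have -> : y i - f = \sum_j b (t j) *: w j.
    rewrite (re _ (fun j => b j *: (v j - f))).
    under [RHS]eq_bigr do rewrite scalerBr.
    by rewrite sumrB -yb -scaler_suml b1 scale1r.
  by move=> l; rewrite (tri_dot_comb _ _ T) (re _ b) b1.
have on i : dot (row i B) (y i - f) = 1.
  by have [b [bi _] e] := ye i; rewrite e bi mul0r subr0.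
have lt i j : i != j -> dot (row j B) (y i - f) < 1.
  move=> ij; have [b [_ bp] ->] := ye i.
  by rewrite ltrBlDr ltrDl divr_gt0 // bp // eq_sym.
have yM i : M f B (y i).
  move=> j; have [<-|/lt/ltW//] := eqVneq i j; by rewrite on.
have bd z : Z2 z -> M f B z -> (boundary (M f B) `&` Z2) z.
  move=> Zz Mz; split=> //; split; first exact: subset_closure.
  by move=> iz; have [_] := lf; rewrite -subset0 => /(_ z); apply.
have yI : injective y.
  move=> i j e; apply/eqP/negPn/negP => ij.
  by have := lt i j ij; rewrite e on ltxx.
exists w, c, y; split.
  split=> //; first by apply/lattice_freeP.
    by move=> i; have [] := yP i.
  (* Any further lattice point of the triangle would be a fourth one on its boundary. *)
  move=> x Zx Mx; apply: contrapT => /forallNP N.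
  pose s4 := [:: x; y 0; y 1; y 2].
  have us4 : uniq s4.
    rewrite /= !inE !(inj_eq yI) /= !andbT !negb_or.
    by rewrite !(introF eqP (N _)).
  have s4in i : (i < 4)%N -> (boundary (M f B) `&` Z2) (nth 0 s4 i).
    by move: i => [|[|[|[|]]]] //= _; apply: bd => //; exact: (yP _).2.
  have : (`I_4 #<= `I_3)%card.
    rewrite -(card_le_eqr card3) -(card_le_eql (@inj_card_eq _ _ `I_4 (nth 0 s4) _)).
      by apply: subset_card_le => _ [i /= i4 <-]; exact: s4in.
    by move=> i j; rewrite !inE /= => i4 j4 /eqP; rewrite nth_uniq // => /eqP.
  by rewrite card_le_II.
rewrite MB; apply/seteqP; split=> x [b [b0 b1 ->]].
  exists (b \o t); split=> //=; first by rewrite (re _ b).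
  rewrite -(re _ (fun j => b j *: v j)); apply: eq_bigr => j _.
  by rewrite /w addrC subrK.
exists (b \o s); split=> //=.
  by rewrite -b1 -[LHS]re; apply: eq_bigr => j _; rewrite /= ts.
rewrite -[RHS]re; apply: eq_bigr => j _; rewrite /= ts.
by rewrite /w addrC subrK.
Qed.

End Alignment.

(** * Tilting the edges about their lattice points *)

Section Tilting.
Variable R : realType.
Implicit Types (f x r : 'rV[R]_2) (B D : 'M[R]_(3, 2)).

Lemma tri_psi_ge0 B w c r : triangle B w c -> 0 <= psi B r.
Proof.
move=> T; have [->|/(tri_psi_gt0 T)/ltW//] := eqVneq r 0.
by have [i ->] := psi_ex B 0; rewrite dot0r.
Qed.

(** Two rows vanish on [r - s *: w l], so by [tri_rows] the third does too. *)
Lemma tri_two_tight B w c r l s : triangle B w c ->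
  (forall m, m != l -> dot (row m B) r = s) -> r = s *: w l.
Proof.
move=> T h; apply/eqP; rewrite -subr_eq0; apply/eqP; set z := r - _.
have z0 m : m != l -> dot (row m B) z = 0.
  by move=> ml; rewrite /z dotBr h // dotZr (tri_dot_off T) // mulr1 subrr.
have := tri_rows z T; rewrite (bigD1 l) //= big1 => [|m /z0 ->]; last first.
  by rewrite mulr0.
rewrite addr0 => zl; rewrite [z](tri_decomp _ T) big1 ?oppr0 // => m _.
have [->|/z0 ->] := eqVneq m l; first by rewrite zl scale0r.
by rewrite mulr0 scale0r.
Qed.

(** Every linear form is controlled by [psi]. In [tri_decomp] each coefficient is at most [psi B r]
    from above directly, and from below because the coefficients sum to zero. *)
Lemma tri_bound B w c u r : triangle B w c ->
  `|dot u r| <= psi B r * \sum_i `|dot u (w i)|.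
Proof.
move=> T; have p0 := tri_psi_ge0 r T.
have le i : c i * dot (row i B) r <= c i * psi B r.
  by rewrite ler_pM2l ?(tri_gt0 T) // psi_ge.
have b i : `|c i * dot (row i B) r| <= psi B r.
  move: (tri_sum T) (tri_rows r T); rewrite (bigD1 i) //= => s1.
  rewrite (bigD1 i) //= => s2.
  have lec : \sum_(j | j != i) c j * dot (row j B) r <=
      (\sum_(j | j != i) c j) * psi B r.
    by rewrite mulr_suml; apply: ler_sum => j _; exact: le.
  have s0 : 0 <= \sum_(j | j != i) c j.
    by apply: sumr_ge0 => j _; exact/ltW/(tri_gt0 T).
  have := le i; have := tri_gt0 T i; rewrite ler_norml => ci li.
  apply/andP; split; nra.
rewrite {1}(tri_decomp r T) dotNr normrN dot_sumr mulr_sumr.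
apply: (le_trans (ler_norm_sum _ _ _)); apply: ler_sum => i _.
by rewrite dotZr normrM ler_wpM2r.
Qed.

(* Local finiteness of the lattice makes lattice-freeness strict, uniformly,
   away from the [y i]. *)
Lemma type3_gap f B w c y : type3 f B w c y ->
  exists2 h, 0 < h & forall x, Z2 x -> (forall i, x != y i) ->
    1 + h <= psi B (x - f).
Proof.
move=> T3; have T := t3_tri T3.
have gt1 x : Z2 x -> (forall i, x != y i) -> 1 < psi B (x - f).
  move=> Zx N; rewrite ltNge; apply/negP => le1.
  have [i e] : exists i, x = y i.
    by apply: (t3_uniq T3) => // i; apply: le_trans le1; exact: psi_ge.
  by have := N i; rewrite e eqxx.
pose E k : 'rV[R]_2 := delta_mx 0 k.
have EE k z : dot (E k) z = z 0 k.
  rewrite dotE !mxE; case: k => [[|[|//]] h] /=; rewrite ?mul1r ?mul0r.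
    by rewrite addr0; congr (z _ _); apply/val_inj.
  by rewrite add0r; congr (z _ _); apply/val_inj.
(* By [tri_bound] the points with [psi] at most 2 lie in a box, which holds finitely many lattice
   points. *)
have [N NP] : exists N : nat, forall x, psi B (x - f) <= 2 ->
    forall k, `|x 0 k| <= N%:R.
  pose K := \sum_k (`|f 0 k| + 2 * \sum_i `|dot (E k) (w i)|).
  exists (Num.trunc K).+1 => x le2 k.
  apply: (@le_trans _ _ K); last by apply/ltW; exact: truncnS_gt.
  have -> : x 0 k = dot (E k) (x - f) + f 0 k by rewrite EE !mxE subrK.
  rewrite /K (bigD1 k) //=; set Z := (X in _ <= _ + X).
  have Z0 : 0 <= Z.
    apply: sumr_ge0 => j _; rewrite addr_ge0 // mulr_ge0 //.
    by apply: sumr_ge0 => *.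
  have := tri_bound (E k) (x - f) T.
  have S0 : 0 <= \sum_i `|dot (E k) (w i)| by apply: sumr_ge0 => *.
  have := ler_normD (dot (E k) (x - f)) (f 0 k).
  have := tri_psi_ge0 (x - f) T; nra.
(* The integer points of the box, with coordinates shifted by [N] to become natural numbers. *)
pose pt (p : 'I_(2 * N).+1 * 'I_(2 * N).+1) : 'rV[R]_2 :=
  \row_k (if k == 0 then (p.1%:R - N%:R) else (p.2%:R - N%:R)).
have : \forall h \near (0 : R)^'+, forall p : 'I_(2 * N).+1 * 'I_(2 * N).+1,
    (forall i, pt p != y i) -> Z2 (pt p) -> h < psi B (pt p - f) - 1.
  apply: filter_forall => p.
  have [[N1 Zp]|nP] := pselect ((forall i, pt p != y i) /\ Z2 (pt p)).
    have : 0 < psi B (pt p - f) - 1 by rewrite subr_gt0 gt1.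
    by move=> /nbhs_right_lt; apply: filterS.
  by apply: filterE => h N1 Zp; case: nP.
move=> near1; have near2 := nbhs_right_gt (0 : R).
(* With [h < 1], a point violating the gap has [psi] below 2 and so lies in the box. *)
have near3 := nbhs_right_lt (ltr01 : (0 : R) < 1).
have [h [[hp h0] h1]] := filter_ex (filterI (filterI near1 near2) near3).
exists h => // x Zx Nx; rewrite leNgt; apply/negP => lt.
have lt2 : psi B (x - f) <= 2 by move: h1 => /= h1; lra.
have crd k : exists i : 'I_(2 * N).+1, x 0 k = i%:R - N%:R.
  have /intrP[z ez] := Zx k; have := NP x lt2 k.
  rewrite ez -intr_norm -[N%:R]/(N%:Z%:~R) ler_int => leN.
  have zN : (absz (z + N%:Z)%R < (2 * N).+1)%N by lia.
  exists (Ordinal zN) => /=.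
  have -> : (absz (z + N%:Z)%R)%:R = (z + N%:Z)%:~R :> R.
    by rewrite -[LHS]/((absz _)%:Z%:~R); congr (_%:~R); lia.
  by rewrite intrD addrK.
have [[i ei] [j ej]] := (crd 0, crd 1).
have ex : x = pt (i, j) by apply: row2P; rewrite !mxE.
have := hp (i, j); rewrite -ex => /(_ Nx Zx); lra.
Qed.

(** Edge [i] still passes through [y i]. At any other lattice point [p = psi B (x - f)] is at least
    [1 + h], and the active row loses at most [|e| * K * p], so [|e| * K * (1 + h) <= h] keeps it at
    1 or more. *)
Lemma tilt_lattice_free f B D w c y : type3 f B w c y ->
  (forall i, dot (row i D) (y i - f) = 0) ->
  \forall e \near (0 : R), lattice_free (M f (B + e *: D)).
Proof.
move=> T3 hD; have T := t3_tri T3; have [h h0 gap] := type3_gap T3.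
pose K := \sum_i \sum_j `|dot (row i D) (w j)|.
have K0 : 0 <= K by do 2!apply: sumr_ge0 => ? _.
have rowD e i r : dot (row i (B + e *: D)) r =
    dot (row i B) r + e * dot (row i D) r.
  by rewrite linearD linearZ /= dotDl dotZl.
have KP i r : `|dot (row i D) r| <= psi B r * K.
  apply: (le_trans (tri_bound _ _ T)); apply: ler_wpM2l.
    exact: tri_psi_ge0 T.
  rewrite /K [leRHS](bigD1 i) //= lerDl; by do 2!apply: sumr_ge0 => ? _.
have hK : 0 < (1 + h) * (K + 1) by nra.
apply/nbhs_ballP; exists (h / ((1 + h) * (K + 1))) => /=; first exact: divr_gt0.
move=> e; rewrite /ball /= sub0r normrN ltr_pdivlMr //.
move=> eh; apply/lattice_freeP => x Zx.
have [/existsP[i /eqP ->]|/existsPn N] := boolP [exists i, x == y i].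
  by exists i; rewrite rowD hD (t3_on T3) mulr0 addr0.
have [i ei] := psi_ex B (x - f); exists i; rewrite rowD -ei.
have := gap x Zx N; have := KP i (x - f); set d := dot (row i D) _.
set p := psi _ _ => kp gp.
have : `|e * d| <= `|e| * (p * K) by rewrite normrM ler_wpM2l.
have e0 : 0 <= `|e| by [].
move=> h2; have h3 : - (e * d) <= `|e| * (p * K).
  by apply: le_trans h2; rewrite -normrN ler_norm.
have h4 : `|e| * K * (1 + h) <= h by nra.
have h5 : `|e| * K <= 1 by nra.
nra.
Qed.

(** Rows active at [r] change equally by hypothesis, and the inactive ones stay below them for small
    [e]. *)
Lemma tilt_psi B D r i : dot (row i B) r = psi B r ->
  (forall j, dot (row j B) r = psi B r ->
     dot (row j D) r = dot (row i D) r) ->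
  \forall e \near (0 : R), psi (B + e *: D) r = psi B r + e * dot (row i D) r.
Proof.
move=> ai hD.
have rowD e j : dot (row j (B + e *: D)) r =
    dot (row j B) r + e * dot (row j D) r.
  by rewrite linearD linearZ /= dotDl dotZl.
have : \forall e \near (0 : R), forall j,
    dot (row j (B + e *: D)) r <= dot (row i (B + e *: D)) r.
  apply: (@filter_forall _ _ (fun j (e : R) => dot (row j (B + e *: D)) r <=
    dot (row i (B + e *: D)) r) (nbhs (0 : R)) (nbhs_filter _)) => j.
  have [aj|naj] := eqVneq (dot (row j B) r) (psi B r).
    by apply: filterE => e; rewrite !rowD aj hD // ai.
  set d := dot (row i D) r - dot (row j D) r.
  have lt : dot (row j B) r < psi B r by rewrite lt_neqAle naj psi_ge.
  have d1 : 0 < `|d| + 1 by rewrite ltr_wpDl.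
  apply/nbhs_ballP; exists ((psi B r - dot (row j B) r) / (`|d| + 1)) => /=.
    by rewrite divr_gt0 // subr_gt0.
  move=> e; rewrite /ball /= sub0r normrN ltr_pdivlMr // => eh.
  rewrite !rowD ai.
  have : - (e * d) <= `|e| * `|d| by rewrite -normrM -normrN ler_norm.
  have : 0 <= `|e| by []. 
  rewrite /d; nra.
by apply: filterS => e /psi_eq ->; rewrite rowD ai.
Qed.

(* [gamma r B] is the midpoint of [gamma r (B + e D)] and [gamma r (B - e D)]
   for small [e > 0]. *)
Lemma tilt_split k f (r : 'I_k -> 'rV[R]_2) B D w c y : type3 f B w c y ->
  (forall i, dot (row i D) (y i - f) = 0) ->
  (forall j i i', dot (row i B) (r j) = psi B (r j) ->
     dot (row i' B) (r j) = psi B (r j) ->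
     dot (row i' D) (r j) = dot (row i D) (r j)) ->
  (exists j i, dot (row i B) (r j) = psi B (r j) /\ dot (row i D) (r j) != 0) ->
  exists g1 g2, [/\ Delta f r g1, Delta f r g2 &
    strict_convex_combination (gamma r B) g1 g2].
Proof.
move=> T3 hD hr [j0 [i0 [a0 d0]]].
have /choice[a aP] : forall j, exists i, psi B (r j) = dot (row i B) (r j).
  by move=> j; exact: psi_ex.
have : \forall e \near (0 : R), forall j,
    psi (B + e *: D) (r j) = psi B (r j) + e * dot (row (a j) D) (r j).
  apply: (@filter_forall _ _ (fun j (e : R) => psi (B + e *: D) (r j) =
    psi B (r j) + e * dot (row (a j) D) (r j)) (nbhs (0 : R)) (nbhs_filter _)).
  by move=> j; apply: tilt_psi => // i ai; exact: hr.
move=> /filterI/(_ (tilt_lattice_free T3 hD)) /nbhs_ballP[t /= t0 tP].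
have [p1 l1] := tP (t / 2) ltac:(rewrite /ball /= sub0r normrN ger0_norm; lra).
have [p2 l2] := tP (- (t / 2)) ltac:(rewrite /ball /= sub0r opprK ger0_norm; lra).
exists (gamma r (B + (t / 2) *: D)), (gamma r (B + (- (t / 2)) *: D)); split.
- by exists (B + (t / 2) *: D).
- by exists (B + (- (t / 2)) *: D).
split; last by apply/rowP => j; rewrite !mxE p1 p2; field.
move=> /rowP/(_ j0); rewrite !mxE p1 p2 (hr j0 i0) // => e.
have : t * dot (row i0 D) (r j0) = 0 by lra.
by move/eqP; rewrite mulf_eq0 (negPf d0) orbF gt_eqF.
Qed.

(** The vanishing determinant makes [r] parallel to [y i - f], and row [i], being 1 on [y i - f],
    reads off the factor. *)
Lemma type3_det B f w c y r i s : type3 f B w c y -> 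
  dot (row i B) r = s -> det2 (y i - f) r = 0 -> r = s *: (y i - f).
Proof.
move=> T3 <-; have := t3_on T3 i; rewrite /det2 !dotE.
set z := y i - f; set b := row i B => on d.
apply: row2P; rewrite [RHS]mxE.
  transitivity (r 0 0 * (b 0 0 * z 0 0 + b 0 1 * z 0 1) +
    b 0 1 * (z 0 0 * r 0 1 - z 0 1 * r 0 0)); last by ring.
  by rewrite on d; ring.
transitivity (r 0 1 * (b 0 0 * z 0 0 + b 0 1 * z 0 1) -
  b 0 0 * (z 0 0 * r 0 1 - z 0 1 * r 0 0)); last by ring.
by rewrite on d; ring.
Qed.

(** Otherwise [y i] would be the end [f + w l] of its edge, where a second row is tight. *)
Lemma type3_det_vertex B f w c y i l : type3 f B w c y -> i != l ->
  det2 (y i - f) (w l) != 0.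
Proof.
move=> T3 il; have T := t3_tri T3; apply/eqP => d.
have wy := type3_det T3 (tri_dot_off T il) d.
have [m /andP[mi ml]] : exists m : 'I_3, (m != i) && (m != l).
  exists (- (i + l)); move: il; clear.
  by case: i l => [[|[|[|]]]] // ? [[|[|[|]]]].
have := t3_lt T3 (i := i) (j := m); rewrite eq_sym => /(_ mi).
by rewrite -[y i - f]scale1r -wy (tri_dot_off T ml) ltxx.
Qed.

Lemma type3_vert B f w c y x : type3 f B w c y ->
  vert f B x <-> exists l, x = f + w l.
Proof.
move=> T3; have T := t3_tri T3; split=> [[Mx ext]|[l ->]]; last first.
  have wl : f + w l - f = w l by rewrite addrAC subrr add0r.
  split=> [i|u z t Mu Mz /andP[t0 t1] e].
    rewrite wl (tri_dot T) lerBlDr lerDl.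
    by rewrite divr_ge0 // ltW // (tri_gt0 T).
  have tight m : m != l -> dot (row m B) (u - f) = 1 /\ dot (row m B) (z - f) = 1.
    move=> ml; have := tri_dot_off T ml; rewrite -wl e.
    have -> : t *: u + (1 - t) *: z - f = t *: (u - f) + (1 - t) *: (z - f).
      by apply/rowP => k; rewrite !mxE; ring.
    rewrite (dotDr _ (_ *: _)) !dotZr; have := Mu m; have := Mz m.
    set a := dot _ _; set b := dot _ _ => b1 a1 h.
    have b2 : 1 <= b by nra.
    have a2 : 1 <= a by nra.
    by split; apply/eqP; rewrite eq_le ?b1 ?a1 ?b2 ?a2.
  have eu := tri_two_tight T (fun m h => (tight m h).1).
  have ez := tri_two_tight T (fun m h => (tight m h).2).
  by apply: (addIr (- f)); rewrite eu ez.
suff [l tight] : exists l, forall m, m != l -> dot (row m B) (x - f) = 1.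
  exists l; have := tri_two_tight T tight; rewrite scale1r => <-.
  by rewrite addrC subrK.
apply: contrapT => /forallNP N.
have strict l : exists2 m, m != l & dot (row m B) (x - f) < 1.
  apply: contrapT => /forall2NP H; apply: (N l) => m ml.
  apply/eqP; rewrite eq_le Mx leNgt; apply/negP => lt.
  by case: (H m).
have [i _ xi] := strict 0; have [j ji xj] := strict i.
(* Rows [i] and [j] have slack, and the third row vanishes on [w i - w j]; so [x] can move both ways
   in this direction. The scaled slack [a] bounds the step length. *)
pose a m := c m * (1 - dot (row m B) (x - f)).
have ap m : dot (row m B) (x - f) < 1 -> 0 < a m.
  by move=> h; rewrite mulr_gt0 ?(tri_gt0 T) // subr_gt0.
have [s s0 /andP[si sj]] : exists2 s, 0 < s & (s <= a i) && (s <= a j).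
  by exists (Num.min (a i) (a j)); rewrite ?lt_min ?ap // !ge_min !lexx ?orbT.
have dd m : dot (row m B) (w i - w j) = (m == j)%:R / c m - (m == i)%:R / c m.
  by rewrite dotBr !(tri_dot T); case: eqP => [->|]; case: eqP => [->|] *; ring.
have Mp (e : R) : `|e| <= s -> M f B (x + e *: (w i - w j)).
  rewrite ler_norml => /andP[e1 e2] m; rewrite addrAC (dotDr _ (x - f)) dotZr dd.
  have cm := tri_gt0 T m.
  rewrite -(ler_pM2l cm) mulrDr.
  have -> : c m * (e * ((m == j)%:R / c m - (m == i)%:R / c m)) =
      e * ((m == j)%:R - (m == i)%:R) by field; rewrite gt_eqF.
  have := Mx m => /= Mm.
  have [mj|mj] := eqVneq m j; have [mi|mi] := eqVneq m i;
    rewrite /= ?mulr1n ?mulr0n.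
  - by rewrite subrr; nra.
  - by move: sj; rewrite /a -mj; lra.
  - by move: si; rewrite /a -mi; lra.
  - by rewrite subrr; nra.
have := ext (x + s *: (w i - w j)) (x + (- s) *: (w i - w j)) 2^-1.
have sn : `|s| <= s by rewrite ger0_norm // ltW.
move=> /(_ (Mp _ sn)); rewrite -(normrN s) in sn => /(_ (Mp _ sn)).
have -> : 0 < (2^-1 : R) < 1 by apply/andP; split; lra.
move=> /(_ erefl) H.
have : s *: (w i - w j) = (- s) *: (w i - w j).
  apply: (addrI x); apply: H.
  by apply/rowP => k; rewrite !mxE; field.
move=> /(congr1 (dot (row i B))); rewrite !dotZr dd eqxx.
rewrite eq_sym (negPf ji) => /eqP; rewrite -subr_eq0 -mulrBl mulf_eq0.
have ci : 0 < (c i)^-1 by rewrite invr_gt0 (tri_gt0 T).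
by rewrite mul0r mul1r; move=> /orP[] /eqP; lra.
Qed.

Lemma type3_tilt k f (r : 'I_k -> 'rV[R]_2) B w c y : type3 f B w c y ->
  ~ ray_intersections f r B `<=` Z2 ->
  ~ vert f B `<=` ray_intersections f r B ->
  exists g1 g2, [/\ Delta f r g1, Delta f r g2 &
    strict_convex_combination (gamma r B) g1 g2].
Proof.
move=> T3 /existsNP[p /not_implyP[[j0 /= pj0 <-] nZ]].
move=> /existsNP[v0 /not_implyP[/(type3_vert _ T3)[l0 ->] nP]].
have T := t3_tri T3.
pose z i := y i - f.
(* The corner equations at the two vertices other than [l0] each involve edge
   [l0] and one of the other edges, so they can be solved starting from
   [dl l0 = 1]; [- (i + l0)] is the third index. *)
pose dl i := if i == l0 then 1 else
  det2 (z l0) (w (- (i + l0))) / det2 (z i) (w (- (i + l0))).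
(* Row [i] is [y i - f] turned by a right angle and scaled by [dl i]. *)
pose D : 'M[R]_(3, 2) :=
  \matrix_(i, j) (dl i * (if j == 0 then - z i 0 1 else z i 0 0)).
have DE i u : dot (row i D) u = dl i * det2 (z i) u.
  by rewrite dotE !mxE /det2 /z !mxE /=; ring.
have third (i i' : 'I_3) : i != i' ->
    [/\ - (i + i') != i, - (i + i') != i' &
      forall m, m != - (i + i') -> m = i \/ m = i'].
  move=> ii'; split; move: ii'; clear; move: i i'.
  - by case=> [[|[|[|]]]] // ? [[|[|[|]]]].
  - by case=> [[|[|[|]]]] // ? [[|[|[|]]]].
  - by case=> [[|[|[|]]]] // ? [[|[|[|]]]] // ? _ [[|[|[|]]]] // ? _;
      (try by left; apply/val_inj); right; apply/val_inj.
have dl0 i : dl i != 0.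
  rewrite /dl; have [_|il] := eqVneq i l0; first exact: oner_neq0.
  have [h1 h2 _] := third _ _ il.
  by rewrite mulf_eq0 invr_eq0 negb_or !(type3_det_vertex T3) // eq_sym.
apply: (tilt_split (D := D) T3).
- by move=> i; rewrite DE /det2; ring.
- move=> j i i' ai ai'; rewrite !DE.
  have [->//|ii'] := eqVneq i i'.
  have [r0|rn0] := eqVneq (r j) 0; first by rewrite r0 /det2 !mxE; ring.
  have psi0 := tri_psi_gt0 T rn0.
  have [h1 h2 h3] := third _ _ ii'.
  (* A ray with two active rows runs through their common vertex, which is not [l0] since no ray
     meets that one. *)
  have rw : r j = psi B (r j) *: w (- (i + i')).
    by apply: tri_two_tight T _ => m /h3[] ->.
  have nl0 : - (i + i') != l0.
    apply: contra_notN nP => /eqP <-; exists j => //=.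
    by rewrite {2}rw scalerA mulVf ?scale1r // gt_eqF.
  have sc u : det2 u (r j) = psi B (r j) * det2 u (w (- (i + i'))).
    by rewrite {1}rw /det2 !mxE; ring.
  rewrite !sc mulrCA [RHS]mulrCA; congr (_ * _).
  have di := type3_det_vertex T3 (i := i) (l := - (i + i')).
  have di' := type3_det_vertex T3 (i := i') (l := - (i + i')).
  rewrite eq_sym in di; rewrite eq_sym in di'.
  have [e|e] : l0 = i \/ l0 = i' by apply: h3; rewrite eq_sym.
  + rewrite /dl -e eqxx mul1r eq_sym e (negPf ii') [i' + i]addrC mulfVK //.
    exact: di'.
  + rewrite /dl -e eqxx mul1r e (negPf ii') mulfVK //.
    exact: di.
(* If the tilt did not change [psi] on ray [j0], this ray would leave the triangle at the lattice
   point [y i]. *)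
exists j0; have [i ei] := psi_ex B (r j0); exists i; split=> //.
rewrite DE mulf_eq0 negb_or dl0 /=; apply/eqP => d.
have rj := type3_det T3 (esym ei) d.
apply: nZ; rewrite {2}rj scalerA mulVf ?scale1r ?gt_eqF //.
by rewrite addrC subrK; exact: t3_int T3 i.
Qed.

End Tilting.

(** * Encoding sizes, integral heights and their dyadic levels *)

Section Encoding.
Variable R : realType.
Implicit Types (x : rat) (u f r : 'rV[rat]_2) (y z : 'rV[R]_2).

Definition den u : nat := (absz (denq (u 0%R 0%R)) * absz (denq (u 0%R 1%R)))%N.

Lemma den_gt0 u : (0 < den u)%N.
Proof. by rewrite muln_gt0 !absz_gt0 !denq_neq0. Qed.

Lemma denq_ratr x : (absz (denq x))%:R * ratr x = (numq x)%:~R :> R.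
Proof.
have -> : (absz (denq x))%:R = (denq x)%:~R :> R by rewrite -{2}absz_denq.
by rewrite /ratr mulrC divfK // intr_eq0 denq_neq0.
Qed.

Lemma den_int u k : (den u)%:R * rat_vec R u 0 k \is a Num.int.
Proof.
rewrite mxE /den natrM; case: k => [[|[|//]] h].
  rewrite (_ : Ordinal h = 0); last by apply/val_inj.
  rewrite mulrAC denq_ratr; exact: (rpredM (intr_int _ _) (natr_int _ _)).
rewrite (_ : Ordinal h = 1); last by apply/val_inj.
rewrite -mulrA denq_ratr; exact: (rpredM (natr_int _ _) (intr_int _ _)).
Qed.

Lemma absz_num_size x : (absz (numq x) <= 2 ^ rat_size x)%N.
Proof.
rewrite /rat_size; apply: (@leq_trans (2 ^ up_log 2 (absz (numq x) + 1))).
  by apply: (@leq_trans (absz (numq x) + 1)); rewrite ?leq_addr ?up_logP.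
by rewrite leq_pexp2l //; lia.
Qed.

Lemma absz_den_size x : (absz (denq x) <= 2 ^ rat_size x)%N.
Proof.
rewrite /rat_size; apply: (@leq_trans (2 ^ up_log 2 (absz (denq x) + 1))).
  by apply: (@leq_trans (absz (denq x) + 1)); rewrite ?leq_addr ?up_logP.
by rewrite leq_pexp2l //; lia.
Qed.

Lemma vec_size2 u :
  vec_size u = (2 + (rat_size (u 0%R 0%R) + rat_size (u 0%R 1%R)))%N.
Proof.
rewrite /vec_size big_ord_recl big_ord1.
by congr (_ + (rat_size (u _ _) + rat_size (u _ _)))%N; apply/val_inj.
Qed.

Lemma den_size u : (den u <= 2 ^ vec_size u)%N.
Proof.
rewrite vec_size2 /den.
apply: (@leq_trans (2 ^ (rat_size (u 0%R 0%R) + rat_size (u 0%R 1%R)))).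
  by rewrite expnD leq_mul ?absz_den_size.
by rewrite leq_pexp2l // leq_addl.
Qed.

Lemma norm_ratr_size x : `|ratr x : R| <= (2 ^ rat_size x)%:R.
Proof.
apply: (@le_trans _ _ (absz (numq x))%:R); last by rewrite ler_nat absz_num_size.
have -> : (absz (numq x))%:R = `|(numq x)%:~R| :> R.
  by rewrite -intr_norm -[LHS]/((absz _)%:Z%:~R) abszE.
rewrite -denq_ratr [leRHS]normrM normr_nat ler_peMl // ler1n.
by rewrite absz_gt0 denq_neq0.
Qed.

Lemma norm_vec_size u k : `|rat_vec R u 0 k| <= (2 ^ vec_size u)%:R.
Proof.
rewrite mxE; apply: (le_trans (norm_ratr_size _)).
rewrite ler_nat leq_pexp2l // vec_size2; case: k => [[|[|//]] h].
  rewrite (_ : Ordinal h = 0); [lia | exact/val_inj].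
rewrite (_ : Ordinal h = 1); [lia | exact/val_inj].
Qed.

(** Two products of size at most [2 ^ (2 * S)] each. *)
Lemma det2_size u v S : (vec_size u <= S)%N -> (vec_size v <= S)%N ->
  `|det2 (rat_vec R u) (rat_vec R v)| <= (2 ^ (2 * S + 1))%:R.
Proof.
move=> uS vS.
have le (w : 'rV[rat]_2) (k : 'I_2) : (vec_size w <= S)%N ->
      `|rat_vec R w 0 k| <= (2 ^ S)%:R.
  move=> wS; apply: (le_trans (norm_vec_size _ _)).
  by rewrite ler_nat leq_pexp2l.
apply: (le_trans (ler_normB _ _)).
rewrite !normrM expnD mul2n -addnn expnD expn1 muln2 -addnn natrD !natrM.
by apply: lerD; apply: ler_pM => //; apply: le.
Qed.

(* In a basis [(r', r)], the absolute value of the coordinate of [y - f] along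
   [r'] times [den f * den r * `|det2 r' r|]; this scaling makes it integral at
   lattice points. *)
Definition height f r y : nat :=
  Num.trunc ((den f * den r)%:R * `|det2 (y - rat_vec R f) (rat_vec R r)|).

Lemma heightE f r y : Z2 y ->
  (height f r y)%:R =
    (den f * den r)%:R * `|det2 (y - rat_vec R f) (rat_vec R r)|.
Proof.
move=> Zy; rewrite /height truncK //.
rewrite -[(_ * _)%:R]normr_nat -normrM.
apply: natr_norm_int.
(* Clear denominators by giving [den f] to [y - f] and [den r] to [r]. *)
have -> : (den f * den r)%:R * det2 (y - rat_vec R f) (rat_vec R r) =
  ((den f)%:R * y 0 0 - (den f)%:R * rat_vec R f 0 0) *
    ((den r)%:R * rat_vec R r 0 1) -
  ((den f)%:R * y 0 1 - (den f)%:R * rat_vec R f 0 1) *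
    ((den r)%:R * rat_vec R r 0 0).
  have sub k : (y - rat_vec R f) 0 k = y 0 k - rat_vec R f 0 k by rewrite !mxE.
  by rewrite natrM /det2 !sub; ring.
by apply: rpredB; apply: rpredM; (try exact: den_int); apply: rpredB;
  (try exact: den_int); apply: rpredM; rewrite ?natr_int ?Zy.
Qed.

Definition level f r y : nat := trunc_log 2 (height f r y).

(** Numbers in one dyadic interval differ by a factor below 2. The heights 0 and 1 share level 0, so
    the height of [y] must be nonzero. *)
Lemma level_lt f r y y' : Z2 y -> Z2 y' ->
  det2 (y - rat_vec R f) (rat_vec R r) != 0 -> level f r y = level f r y' ->
  `|det2 (y' - rat_vec R f) (rat_vec R r)| <
    2 * `|det2 (y - rat_vec R f) (rat_vec R r)|.
Proof.
move=> Zy Zy' d e.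
have q0 : 0 < (den f * den r)%:R :> R by rewrite ltr0n muln_gt0 !den_gt0.
have h0 : (0 < height f r y)%N.
  by rewrite -(ltr0n R) heightE // mulr_gt0 // normr_gt0.
rewrite -(ltr_pM2l q0) mulrCA -!heightE // -natrM ltr_nat.
apply: (leq_trans (trunc_log_ltn _ (isT : (1 < 2)%N))).
by rewrite -/(level f r y') -e expnS leq_mul2l /= trunc_logP.
Qed.

End Encoding.

(** * Lattice points in corner cones, and triangles with equal [gamma] *)

Section Cells.
Variable R : realType.
Implicit Types (f x u : 'rV[R]_2) (B : 'M[R]_(3, 2)).

(** The barycentric coordinates of [y i] are the slacks of the rows scaled by [c]; the one at [i] is
    zero. *)
Lemma type3_coords f B w c y i : type3 f B w c y ->
  exists a b, [/\ 0 < a, 0 < b & y i - f = a *: w (i + 1) + b *: w (i + 2)].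
Proof.
move=> T3; have T := t3_tri T3.
pose a m := c m * (1 - dot (row m B) (y i - f)).
have ai : a i = 0 by rewrite /a (t3_on T3) subrr mulr0.
have ap m : i != m -> 0 < a m.
  by move=> im; rewrite mulr_gt0 ?(tri_gt0 T) // subr_gt0 (t3_lt T3).
have [n1 n2] : i != i + 1 /\ i != i + 2 by case: i {a ai ap} => [[|[|[|]]]].
exists (a (i + 1)), (a (i + 2)); rewrite !ap //; split=> //.
have : y i - f = \sum_m a m *: w m.
  rewrite [LHS](tri_decomp _ T) -sumrN.
  transitivity (\sum_m c m *: w m - \sum_m (c m * dot (row m B) (y i - f)) *: w m).
    by rewrite (tri_bary T) sub0r sumrN.
  by rewrite -sumrB; apply: eq_bigr => m _; rewrite -scalerBl /a mulrBr mulr1.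
by rewrite (sum3 _ i) ai scale0r add0r.
Qed.

(* Two lattice points of the open corner cone that are symmetric about [y i]
   both lie on the supporting line of edge [i]. *)
Lemma type3_symmetric f B w c y i a b a' b' u : type3 f B w c y ->
  y i - f = a *: w (i + 1) + b *: w (i + 2) ->
  u = a' *: w (i + 1) + b' *: w (i + 2) -> Z2 u ->
  0 < a + a' -> 0 < a - a' -> 0 < b + b' -> 0 < b - b' -> u = 0.
Proof.
move=> T3 ey eu Zu aD aB bD bB; have T := t3_tri T3.
have [n1 n2 n12] : [/\ i != i + 1, i != i + 2 & i + 1 != i + 2].
  by case: i {ey eu} => [[|[|[|]]]].
have ab : a + b = 1.
  by have := t3_on T3 i; rewrite ey dotDr !dotZr !(tri_dot_off T) // !mulr1.
have rowi s t : dot (row i B) (s *: w (i + 1) + t *: w (i + 2)) = s + t.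
  by rewrite dotDr !dotZr !(tri_dot_off T) // !mulr1.
have others m s t : 0 < s -> 0 < t -> m != i ->
    dot (row m B) (s *: w (i + 1) + t *: w (i + 2)) < s + t.
  move=> s0 t0 mi; rewrite dotDr !dotZr.
  have [->|->] : m = i + 1 \/ m = i + 2.
    move: mi; clear; case: i m => [[|[|[|]]]] // ? [[|[|[|]]]] // ? _;
      (try by left; apply/val_inj); by right; apply/val_inj.
  - rewrite (tri_dot_diag _ T) (tri_dot_off T) // mulr1 ltrD2r.
    by rewrite mulrBr mulr1 ltrBlDr ltrDl mulr_gt0 // invr_gt0 (tri_gt0 T).
  - rewrite (tri_dot_diag _ T) (tri_dot_off T (i := i + 2)) 1?eq_sym //.
    rewrite mulr1 ltrD2l mulrBr mulr1 ltrBlDr ltrDl mulr_gt0 //.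
    by rewrite invr_gt0 (tri_gt0 T).
(* Row [i] is the largest on the open corner cone, so it is the one that cuts off its lattice
   points. *)
have free s t x : 0 < s -> 0 < t -> Z2 x ->
    x - f = s *: w (i + 1) + t *: w (i + 2) -> 1 <= s + t.
  move=> s0 t0 Zx ex; have [m] := t3_free T3 Zx; rewrite ex.
  have [->|mi] := eqVneq m i; first by rewrite rowi.
  by move=> h; apply: (le_trans h); apply/ltW/others.
have Zy := t3_int T3 i.
have ZD : Z2 (y i + u) by move=> k; rewrite mxE; exact: rpredD (Zy k) (Zu k).
have ZB : Z2 (y i - u).
  by move=> k; rewrite !mxE; exact: rpredB (Zy k) (Zu k).
have eD : y i + u - f = (a + a') *: w (i + 1) + (b + b') *: w (i + 2).
  by rewrite addrAC ey eu !scalerDl addrACA.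
have eB : y i - u - f = (a - a') *: w (i + 1) + (b - b') *: w (i + 2).
  by rewrite addrAC ey eu !scalerBl opprD addrACA.
(* The values of row [i] at [y i + u] and [y i - u] sum to 2 and are at least 1, hence both are
   1. *)
have h1 := free _ _ _ aD bD ZD eD; have h2 := free _ _ _ aB bB ZB eB.
have hs : a + a' + (b + b') = 1 by lra.
have [k yk] : exists k, y i + u = y k.
  apply: (t3_uniq T3) => // m; rewrite eD.
  have [->|mi] := eqVneq m i; first by rewrite rowi hs.
  by rewrite -hs; apply/ltW/others.
have ki : k = i.
  apply/eqP/negPn/negP => ki; have := t3_lt T3 ki.
  by rewrite -yk eD rowi hs ltxx.
by move: yk; rewrite ki => /(canRL (addKr _)); rewrite addNr.
Qed.

(* The signs of [e] alternate along a cycle of odd length. *)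
Lemma corner_system (a b e : 'I_3 -> R) :
  (forall i, 0 < a i) -> (forall i, 0 < b i) ->
  (forall i, a i * e (i + 1) + b i * e (i + 2) = 0) -> forall i, e i = 0.
Proof.
move=> a0 b0 h.
have neg i : 0 < e (i + 1) -> e (i + 2) < 0.
  by move=> e1; have := h i; have := a0 i; have := b0 i; nra.
have pos i : e (i + 1) < 0 -> 0 < e (i + 2).
  by move=> e1; have := h i; have := a0 i; have := b0 i; nra.
have e12 (i : 'I_3) : i + 1 + 1 = i + 2 by rewrite -addrA.
have e22 (i : 'I_3) : i + 1 + 2 = i.
  by apply/val_inj; case: i => [[|[|[|]]]].
have e21 (i : 'I_3) : i + 2 + 1 = i.
  by apply/val_inj; case: i => [[|[|[|]]]].
have e222 (i : 'I_3) : i + 2 + 2 = i + 1.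
  by apply/val_inj; case: i => [[|[|[|]]]].
have no_pos i : ~~ (0 < e i).
  apply/negP => ei.
  have h1 : e (i + 1) < 0 by have := neg (i + 2); rewrite e21 e222; exact.
  have h2 : 0 < e (i + 2) := pos _ h1.
  have := neg (i + 1); rewrite e12 e22 => /(_ h2); lra.
move=> i; apply/eqP; rewrite eq_le; apply/andP; split; first by rewrite leNgt.
rewrite leNgt; apply/negP => ei.
by have := pos (i + 2); rewrite e21 e222 => /(_ ei); apply/negP.
Qed.

Lemma psi_le_subset f B B' r : M f B `<=` M f B' -> 0 < psi B r ->
  psi B' r <= psi B r.
Proof.
move=> sub p0; have [i ->] := psi_ex B' r.
have : M f B (f + (psi B r)^-1 *: r).
  by move=> j; rewrite addrAC subrr add0r dotZr mulrC ler_pdivrMr // mul1r psi_ge.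
move=> /sub/(_ i); rewrite addrAC subrr add0r dotZr mulrC.
by rewrite ler_pdivrMr // mul1r.
Qed.

(** The set [M f B] determines [psi] even if the rows are permuted: the exit point of a ray from one
    set lies in the other. *)
Lemma gamma_eq k (r : 'I_k -> 'rV[R]_2) f B w c B' w' c' :
  triangle B w c -> triangle B' w' c' -> M f B = M f B' ->
  gamma r B = gamma r B'.
Proof.
move=> T T' e; apply/rowP => j; rewrite !mxE.
have [->|rn0] := eqVneq (r j) 0.
  have [i ->] := psi_ex B 0; have [i' ->] := psi_ex B' 0.
  by rewrite !dot0r.
apply/eqP; rewrite eq_le; apply/andP; split; apply: (psi_le_subset (f := f));
  by rewrite ?e ?(tri_psi_gt0 T) ?(tri_psi_gt0 T').
Qed.

(** An exit point of one triangle is a lattice point, so it is not interior to the other; this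
    compares [psi] in both directions. *)
Lemma gamma_lattice_eq k (r : 'I_k -> 'rV[R]_2) f B w c y B' w' c' y' :
  type3 f B w c y -> type3 f B' w' c' y' ->
  ray_intersections f r B `<=` Z2 -> ray_intersections f r B' `<=` Z2 ->
  gamma r B = gamma r B'.
Proof.
have half B1 w1 c1 y1 B2 w2 c2 y2 j : type3 f B1 w1 c1 y1 ->
    type3 f B2 w2 c2 y2 -> ray_intersections f r B1 `<=` Z2 -> r j != 0 ->
    psi B1 (r j) <= psi B2 (r j).
  move=> T1 T2 Z1 rn0; have p1 := tri_psi_gt0 (t3_tri T1) rn0.
  have /(t3_free T2)[i] := Z1 _ (ex_intro2 _ _ j p1 erefl).
  rewrite addrAC subrr add0r dotZr mulrC ler_pdivlMr // mul1r => h.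
  exact: le_trans h (psi_ge _ _ _).
move=> T T' Z Z'; apply/rowP => j; rewrite !mxE.
have [->|rn0] := eqVneq (r j) 0.
  have [i ->] := psi_ex B 0; have [i' ->] := psi_ex B' 0.
  by rewrite !dot0r.
apply/eqP; rewrite eq_le; apply/andP; split.
  exact: half T T' Z rn0.
exact: half T' T Z' rn0.
Qed.

End Cells.

(** * Triangles with three corner rays *)

Section Corners.
Variables (R : realType) (k : nat) (f : 'rV[rat]_2) (r : 'I_k -> 'rV[rat]_2).
Implicit Types (B : 'M[R]_(3, 2)) (j : 'I_3 -> 'I_k).

Let fR := rat_vec R f.
Let rR i := rat_vec R (r i).

(* All three vertices lie on rays: [j l] is the index of a ray through vertex
   [l], and [s l] is the value of [psi B] on it. *)
Record corner B w c y (s : 'I_3 -> R) j : Prop := Corner {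
  co_type3 : type3 fR B w c y;
  co_hull : M fR B = conv_hull (fun i => fR + w i);
  co_gt0 : forall l, 0 < s l;
  co_ray : forall l, rR (j l) = s l *: w l }.

Lemma vec_size_input i : (vec_size (r i) <= input_size f r)%N.
Proof. by rewrite /input_size (bigD1 i) //= addnCA leq_addr. Qed.

(** Coordinates in the corner rays depend only on [y i] and [j], so they can be compared between
    triangles; the determinants express them through [height]. *)
Lemma corner_coords B w c y s j i : corner B w c y s j ->
  exists a b, [/\ 0 < a, 0 < b,
    y i - fR = (a * s (i + 1)) *: w (i + 1) + (b * s (i + 2)) *: w (i + 2),
    det2 (y i - fR) (rR (j (i + 2))) =
      a * det2 (rR (j (i + 1))) (rR (j (i + 2))) &
    det2 (y i - fR) (rR (j (i + 1))) =
      - b * det2 (rR (j (i + 1))) (rR (j (i + 2)))].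
Proof.
move=> C; have [a [b [a0 b0 e]]] := type3_coords i (co_type3 C).
have s1 := co_gt0 C (i + 1); have s2 := co_gt0 C (i + 2).
exists (a / s (i + 1)), (b / s (i + 2)).
split; rewrite ?divr_gt0 // ?divfK ?gt_eqF // e !(co_ray C) /det2 !mxE;
  by field; rewrite gt_eqF.
Qed.

Lemma corner_det B w c y s j i : corner B w c y s j ->
  det2 (rR (j (i + 1))) (rR (j (i + 2))) != 0.
Proof.
move=> C; rewrite !(co_ray C).
have := tri_det i (t3_tri (co_type3 C)); rewrite mulf_eq0 negb_or => /andP[_ d].
have -> : forall a b (u v : 'rV[R]_2), det2 (a *: u) (b *: v) = a * b * det2 u v.
  by move=> a b u v; rewrite /det2 !mxE; ring.
by rewrite !mulf_neq0 // gt_eqF // (co_gt0 C).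
Qed.

(** Equal levels give [a' < 2 * a] and [b' < 2 * b], so [y' i] and its reflection in [y i] both lie
    in the open corner cone, and [type3_symmetric] applies. *)
Lemma corner_cell B w c y s B' w' c' y' s' j i :
  corner B w c y s j -> corner B' w' c' y' s' j ->
  level f (r (j (i + 1))) (y i) = level f (r (j (i + 1))) (y' i) ->
  level f (r (j (i + 2))) (y i) = level f (r (j (i + 2))) (y' i) ->
  y i = y' i.
Proof.
move=> C C' l1 l2; have d0 := corner_det i C.
have [a [b [a0 b0 e e2 e1]]] := corner_coords i C.
have [a' [b' [a'0 b'0 e' e2' e1']]] := corner_coords i C'.
have Zy := t3_int (co_type3 C) i; have Zy' := t3_int (co_type3 C') i.
have aa : a' < 2 * a.
  have := level_lt Zy Zy' _ l2; rewrite -/fR -/(rR _) e2 e2' !normrM mulrA.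
  rewrite ltr_pM2r ?normr_gt0 // !gtr0_norm //; apply.
  by rewrite mulf_neq0 // gt_eqF.
have bb : b' < 2 * b.
  have := level_lt Zy Zy' _ l1.
  rewrite -/fR -/(rR _) e1 e1' !normrM !normrN mulrA.
  rewrite ltr_pM2r ?normr_gt0 // !gtr0_norm //; apply.
  by rewrite mulf_neq0 // oppr_eq0 gt_eqF.
have s1 := co_gt0 C (i + 1); have s2 := co_gt0 C (i + 2).
have ed : y' i - y i = ((a' - a) * s (i + 1)) *: w (i + 1) +
    ((b' - b) * s (i + 2)) *: w (i + 2).
  have -> : y' i - y i = (y' i - fR) - (y i - fR).
    by rewrite opprB addrA subrK.
  have h l : s l *: w l = s' l *: w' l by rewrite -(co_ray C) -(co_ray C').
  rewrite e e' -!scalerA -!h !scalerA !mulrBl !scalerBl opprD; apply/rowP => m.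
  by rewrite !mxE; ring.
apply/esym/eqP; rewrite -subr_eq0; apply/eqP.
apply: (type3_symmetric (co_type3 C) e ed).
- by move=> m; rewrite !mxE; apply: rpredB; [exact: Zy' | exact: Zy].
- by rewrite -mulrDl addrC subrK mulr_gt0.
- by rewrite -mulrBl mulr_gt0 //; lra.
- by rewrite -mulrDl addrC subrK mulr_gt0.
- by rewrite -mulrBl mulr_gt0 //; lra.
Qed.

(** By [corner_system] the equations of the three edges determine [s], hence the vertices and the
    hull. *)
Lemma corner_unique B w c y s B' w' c' y' s' j :
  corner B w c y s j -> corner B' w' c' y' s' j -> (forall i, y i = y' i) ->
  gamma rR B = gamma rR B'.
Proof.
move=> C C' yy; have T3 := co_type3 C; have T3' := co_type3 C'.
have T := t3_tri T3; have T' := t3_tri T3'.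
have /choice[a /choice[b ab]] : forall i, exists a b, [/\ 0 < a, 0 < b &
    y i - fR = a *: rR (j (i + 1)) + b *: rR (j (i + 2))].
  move=> i; have [a [b [a0 b0 e _ _]]] := corner_coords i C.
  by exists a, b; rewrite !(co_ray C) !scalerA.
have eq1 B1 w1 c1 y1 s1 i : corner B1 w1 c1 y1 s1 j -> y1 i = y i ->
    a i * s1 (i + 1) + b i * s1 (i + 2) = 1.
  move=> C1 e; rewrite -(t3_on (co_type3 C1) i) e.
  have [n1 n2] : i != i + 1 /\ i != i + 2 by case: i {e} => [[|[|[|]]]].
  have [_ _ ->] := ab i; rewrite dotDr !dotZr !(co_ray C1) !dotZr.
  by rewrite !(tri_dot_off (t3_tri (co_type3 C1))) // !mulr1.
have ss l : s l = s' l.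
  apply/eqP; rewrite -subr_eq0; apply/eqP; move: l.
  apply: (corner_system (a := a) (b := b)) => i; [by case: (ab i) | by case: (ab i) |].
  have := eq1 _ _ _ _ _ i C erefl; have := eq1 _ _ _ _ _ i C' (esym (yy i)).
  by lra.
apply: (gamma_eq (f := fR) _ T T'); rewrite (co_hull C) (co_hull C'); congr conv_hull.
apply/funext => l; congr (_ + _).
apply: (scalerI (lt0r_neq0 (co_gt0 C l))).
by rewrite -(co_ray C) ss -(co_ray C').
Qed.

(** The denominator times the ray is a nonzero lattice vector; a larger coordinate would allow
    shifting [y i] by it both ways within the open cone. *)
Lemma corner_ray_bound B w c y s j i a b l :
  corner B w c y s j -> (l = i + 1 \/ l = i + 2) ->
  0 < a -> 0 < b ->
  y i - fR = (a * s (i + 1)) *: w (i + 1) + (b * s (i + 2)) *: w (i + 2) ->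
  (if l == i + 1 then a else b) <= (den (r (j l)))%:R.
Proof.
move=> C il a0 b0 e; rewrite leNgt; apply/negP => lt.
have s1 := co_gt0 C (i + 1); have s2 := co_gt0 C (i + 2).
have d0 : 0 < (den (r (j l)))%:R :> R by rewrite ltr0n den_gt0.
set d := (den _)%:R in lt d0.
have Zu : Z2 (d *: rR (j l)) by move=> m; rewrite mxE den_int.
suff : d *: rR (j l) = 0.
  rewrite (co_ray C) scalerA => /eqP; rewrite scaler_eq0 mulf_eq0.
  rewrite !gt_eqF ?(co_gt0 C) //= => /eqP wl.
  have [m ml] : exists m, m != l.
    by exists (l + 1); clear; case: l => [[|[|[|]]]].
  have := tri_dot_off (t3_tri (co_type3 C)) ml; rewrite wl dot0r => /eqP.
  by rewrite eq_sym oner_eq0.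
have [l1|l2] := eqVneq l (i + 1).
  move: lt; rewrite {1}l1 eqxx => lt.
  apply: (type3_symmetric (a' := d * s (i + 1)) (b' := 0) (co_type3 C) e) => //.
  - by rewrite l1 (co_ray C) scalerA scale0r addr0.
  - by rewrite -mulrDl mulr_gt0 // addr_gt0.
  - by rewrite -mulrBl mulr_gt0 // subr_gt0.
  - by rewrite addr0 mulr_gt0.
  - by rewrite subr0 mulr_gt0.
case: il => [|il]; first by move/eqP; rewrite (negPf l2).
move: lt; rewrite (negPf l2) => lt.
apply: (type3_symmetric (a' := 0) (b' := d * s (i + 2)) (co_type3 C) e) => //.
- by rewrite il (co_ray C) scalerA scale0r add0r.
- by rewrite addr0 mulr_gt0.
- by rewrite subr0 mulr_gt0.
- by rewrite -mulrDl mulr_gt0 // addr_gt0.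
- by rewrite -mulrBl mulr_gt0 // subr_gt0.
Qed.

Let S := input_size f r.

Lemma level_bound B w c y s j i l : corner B w c y s j ->
  l = i + 1 \/ l = i + 2 ->
  (level f (r (j l)) (y i) < 5 * S + 2)%N.
Proof.
move=> C il; have [a [b [a0 b0 e e2 e1]]] := corner_coords i C.
have n12 : (i + 2 == i + 1) = false by case: i {e e1 e2 il} => [[|[|[|]]]].
have b1 := corner_ray_bound C (or_introl erefl) a0 b0 e.
have b2 := corner_ray_bound C (or_intror erefl) a0 b0 e.
rewrite eqxx in b1; rewrite n12 in b2.
have le_den u : (vec_size u <= S)%N -> (den u)%:R <= (2 ^ S)%:R :> R.
  by move=> uS; rewrite ler_nat (leq_trans (den_size u)) // leq_pexp2l.
have fS : (vec_size f <= S)%N by rewrite /S /input_size leq_addr.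
have rS m : (vec_size (r m) <= S)%N := vec_size_input m.
have dS := det2_size R (rS (j (i + 1))) (rS (j (i + 2))).
have hb : (height f (r (j l)) (y i) <= 2 ^ (5 * S + 1))%N.
  rewrite -(ler_nat R) heightE; last exact: t3_int (co_type3 C) i.
  (* One factor [2 ^ S] for each of [den f], [den r] and the coordinate, and [2 ^ (2 * S + 1)] for
     the determinant of the rays. *)
  have -> : (2 ^ (5 * S + 1))%:R =
      (2 ^ S)%:R * (2 ^ S)%:R * ((2 ^ S)%:R * (2 ^ (2 * S + 1))%:R) :> R.
    by rewrite -!natrM -!expnD; congr (2 ^ _)%:R; lia.
  rewrite natrM; apply: ler_pM; rewrite ?mulr_ge0 //.
    by apply: ler_pM; rewrite ?le_den.
  by case: il => ->; rewrite -/fR -/(rR _) ?e1 ?e2 ?mulNr ?normrN normrM;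
    apply: ler_pM => //; rewrite gtr0_norm //; apply: le_trans (le_den _ (rS _));
    [exact: b2 | exact: b1].
by rewrite addn2 ltnS (leq_trans (leq_trunc_log 2 hb)) // trunc_expnK // addn1.
Qed.

End Corners.

(** * Counting the exceptional vectors by finite codes *)

Section Counting.

(** A relation suffices as [code]: an element may have many codes, and a decoder [F] chosen on [C]
    covers [A]. *)
Lemma card_le_coding (T : Type) (A : set T) (C : finType)
    (code : T -> C -> Prop) :
  (forall x, A x -> exists c, code x c) ->
  (forall x x' c, A x -> A x' -> code x c -> code x' c -> x = x') ->
  (A #<= `I_#|C|)%card.
Proof.
move=> ex inj.
have [->|/set0P[x0 Ax0]] := eqVneq A set0; first exact: card_ge0.
have /choice[F FP] : forall i : 'I_#|C|, exists x,
    (exists2 x', A x' & code x' (enum_val i)) -> A x /\ code x (enum_val i).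
  move=> i.
  have [[x Ax cx]|N] := pselect (exists2 x', A x' & code x' (enum_val i)).
    by exists x.
  by exists x0 => /N.
have sub : A `<=` F @` [set: 'I_#|C|].
  move=> x Ax; have [c cx] := ex x Ax; exists (enum_rank c) => //.
  have /FP[AF cF] : exists2 x', A x' & code x' (enum_val (enum_rank c)).
    by exists x; rewrite ?enum_rankK.
  by apply: (inj _ _ c AF Ax _ cx); rewrite enum_rankK in cF.
rewrite (card_le_eqr card_II).
exact: card_le_trans (subset_card_le sub) (card_image_le _ _).
Qed.

Definition case_ab (R : realType) k (f : 'rV[R]_2) (r : 'I_k -> 'rV[R]_2) :
    set 'rV[R]_k :=
  [set gamma r B | B in
    [set B : 'M[R]_(3, 2) | type3_triangle (M f B) /\
       (ray_intersections f r B `<=` Z2 \/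
        vert f B `<=` ray_intersections f r B)]].

Lemma corner_of_vert (R : realType) k (f : 'rV[rat]_2) (r : 'I_k -> 'rV[rat]_2)
    (B : 'M[R]_(3, 2)) w c y :
  type3 (rat_vec R f) B w c y ->
  M (rat_vec R f) B = conv_hull (fun i => rat_vec R f + w i) ->
  vert (rat_vec R f) B `<=`
    ray_intersections (rat_vec R f) (fun j => rat_vec R (r j)) B ->
  exists s j, corner f r B w c y s j.
Proof.
move=> T3 MB sub.
have /choice[j jP] : forall l, exists j, 0 < psi B (rat_vec R (r j)) /\
    (psi B (rat_vec R (r j)))^-1 *: rat_vec R (r j) = w l.
  move=> l; have [|j /= p0 /addrI e] := sub (rat_vec R f + w l).
    by apply/(type3_vert _ T3); exists l.
  by exists j.
exists (fun l => psi B (rat_vec R (r (j l)))), j; split=> // l.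
  by case: (jP l).
have [p0 <-] := jP l.
by rewrite scalerA mulfV ?scale1r // gt_eqF.
Qed.

Lemma card_case_ab (R : realType) k (f : 'rV[rat]_2) (r : 'I_k -> 'rV[rat]_2) :
  (case_ab (rat_vec R f) (fun j => rat_vec R (r j)) #<=
    `I_((input_size f r ^ 3 * (5 * input_size f r + 2) ^ 6).+1))%card.
Proof.
set fR := rat_vec R f; set rR := fun j => _; set S := input_size f r.
pose lev := {ffun 'I_3 -> 'I_(5 * S + 2)}.
(* [None] stands for case a, with its single [gamma]. Case b is coded by three corner rays and two
   levels for each edge. *)
pose C : finType := option ({ffun 'I_3 -> 'I_k} * (lev * lev)).
have cardC : (#|{: C}| <= (S ^ 3 * (5 * S + 2) ^ 6).+1)%N.
  rewrite card_option !card_prod !card_ffun !card_ord ltnS leq_mul //.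
    (* Each ray contributes at least 1 to the input size, so [k <= S]. *)
    rewrite leq_exp2r // /S /input_size.
    rewrite -[X in (X <= _)%N]card_ord -sum1_card.
    apply: leq_trans (leq_addl _ _); apply: leq_sum => i _.
    by rewrite vec_size2.
  by rewrite -expnD.
pose code (g : 'rV[R]_k) (x : C) := exists B w c y,
  [/\ g = gamma rR B, type3 fR B w c y &
    match x with
    | None => ray_intersections fR rR B `<=` Z2
    | Some (j, (p, q)) => exists2 s, corner f r B w c y s j & forall i,
        p i = level f (r (j (i + 1))) (y i) :> nat /\
        q i = level f (r (j (i + 2))) (y i) :> nat
    end].
apply: (@card_le_trans _ _ _ `I_#|C|); last by rewrite card_le_II.
apply: (card_le_coding (code := code)) => [_ [B [/type3_triangleP] + + <-]|].
  move=> [w [c [y [T3 MB]]]] [a|b].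
    by exists None, B, w, c, y.
  have [s [j Cj]] := corner_of_vert T3 MB b.
  have bd1 i := level_bound Cj (i := i) (or_introl erefl).
  have bd2 i := level_bound Cj (i := i) (or_intror erefl).
  pose p : lev := [ffun i => Ordinal (bd1 i)].
  pose q : lev := [ffun i => Ordinal (bd2 i)].
  exists (Some ([ffun i => j i], (p, q))), B, w, c, y; split=> //.
  have -> : ([ffun i => j i] : {ffun 'I_3 -> 'I_k}) = j :> ('I_3 -> 'I_k).
    by apply/funext => i; rewrite ffunE.
  by exists s => // i; rewrite !ffunE.
move=> g g' x _ _ [B [w [c [y [-> T3 cx]]]]] [B' [w' [c' [y' [-> T3' cx']]]]].
case: x cx cx' => [[j [p q]]|] cx cx'; last exact: gamma_lattice_eq T3 T3' cx cx'.
have [s Cj lv] := cx; have [s' Cj' lv'] := cx'.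
apply: (corner_unique Cj Cj') => i.
have [p1 q1] := lv i; have [p2 q2] := lv' i.
by apply: (corner_cell Cj Cj'); rewrite -?p1 -?p2 -?q1 -?q2.
Qed.

End Counting.

Theorem proposition3p13 (R : realType) :
  exists p : {poly nat},
  forall (k : nat) (f : 'rV[rat]_2) (r : 'I_k -> 'rV[rat]_2),
  let fR := rat_vec R f in
  let rR := fun j => rat_vec R (r j) in
  exists Xi3 : set 'rV[R]_k,
    [/\ Xi3 `<=` Delta3 fR rR,
        finite_set Xi3,
        forall g, (Delta3 fR rR `\` Xi3) g ->
          exists g1 g2, [/\ Delta fR rR g1, Delta fR rR g2
                          & strict_convex_combination g g1 g2],
        (Xi3 #<= `I_(p.[input_size f r]))%card
      & Xi3 = [set gamma rR B | B in
                [set B : 'M[R]_(3, 2) | type3_triangle (M fR B) /\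
                   (ray_intersections fR rR B `<=` Z2 \/
                    vert fR B `<=` ray_intersections fR rR B)]]].
Proof.
(* The bound of [card_case_ab] as a polynomial in the input size. *)
exists ('X^3 * (5%:P * 'X + 2%:P) ^+ 6 + 1%:P) => k f r fR rR.
have card := card_case_ab R f r.
exists (case_ab fR rR); split=> //.
- by move=> _ [B [T _] <-]; exists B.
- exact: card_le_finite card (finite_II _).
- move=> _ [[B T <-] N].
  have [w [c [y [T3 _]]]] := type3_triangleP T.
  apply: (type3_tilt T3) => h; apply: N; exists B => //; split=> //.
    by left.
  by right.
suff -> : ('X^3 * (5%:P * 'X + 2%:P) ^+ 6 + 1%:P : {poly nat}).[input_size f r] =
  (input_size f r ^ 3 * (5 * input_size f r + 2) ^ 6).+1 by [].
rewrite hornerD hornerM hornerXn horner_exp hornerD hornerM hornerX !hornerC.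
by rewrite -[RHS]addn1.
Qed.
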